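(* Let $M$ be a closed oriented $3$-manifold, let $f:M\hookrightarrow\mathbb{C}^3$ be an embedding of class $\mathcal{C}^k$ ($k\ge1$) with Gauss map $G$, and let $x\in M$ be an isolated complex tangent of $f$. Let $\mathbf{B}$ be a neighborhood of $x$ in $M$, which is an embedded open $3$-ball whose closure is contained in an open set whose closure contains no complex tangent of $f$ other than $x$, and let $\mathbf{S}=\partial\mathbf{B}\cong S^2$. If $x$ can be removed locally, i.e. if there exists a $\mathcal{C}^k$-embedding $\widetilde f:M\hookrightarrow\mathbb{C}^3$ with $\widetilde f=f$ on $M\setminus\mathbf{B}$ and having no complex tangents in $\mathbf{B}$, then $[G(\mathbf{S})]=0\in\pi_2(\mathbb{Y})$.
   Context: $\mathbf{G}_{6,3}$ denotes the Grassmannian of real $3$-dimensional linear subspaces of $\mathbb{C}^3=\mathbb{R}^6$, $J$ is multiplication by $i$ on $\mathbb{C}^3$, and $\mathbb{Y}=\{P\in\mathbf{G}_{6,3}: P\cap J(P)=\{0\}\}$ is the open subset of totally real $3$-planes. For an embedding $f:M\hookrightarrow\mathbb{C}^3$ of a $3$-manifold, the Gauss map $G:M\to\mathbf{G}_{6,3}$ is $G(p)=df_p(T_pM)$. A point $p\in M$ is a complex tangent of $f$ if $G(p)\notin\mathbb{Y}$, i.e. $df_p(T_pM)\cap J(df_p(T_pM))\neq\{0\}$. A complex tangent is isolated if it is an isolated point of the set of complex tangents. For a sphere $\mathbf{S}=\partial\mathbf{B}$ containing no complex tangents, parametrized by an embedding $i:S^2\hookrightarrow M$ with $i(S^2)=\mathbf{S}$,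 the class $[G(\mathbf{S})]$ is the class of $G\circ i:S^2\to\mathbb{Y}$ in $\pi_2(\mathbb{Y})$; $[G(\mathbf{S})]=0$ means that $G\circ i$ is null-homotopic in $\mathbb{Y}$. *)

(* Defs.v *)
(* C^3 is R^6 = ['rV[R]_(3 + 3)], the row vector (x, y) standing for
   x + iy. *)
From HB Require Import structures.
From mathcomp Require Import all_boot all_order all_algebra.
From mathcomp Require Import all_classical all_reals all_analysis.

Set Implicit Arguments.
Unset Strict Implicit.
Unset Printing Implicit Defensive.

Import Order.TTheory GRing.Theory Num.Theory.
Import numFieldNormedType.Exports.

Local Open Scope classical_set_scope.
Local Open Scope ring_scope.

(* On an open [U] of a finite-dimensional space this is the usual notion: all
   partial derivatives of order at most [n] exist and are continuous on [U]. *)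
Fixpoint Cn_on (R : realType) (V W : normedModType R) (n : nat) (U : set V)
    (g : V -> W) : Prop :=
  if n is n'.+1 then
    (forall x, U x -> differentiable g x) /\
    (forall v : V, Cn_on n' U ('D_v g))
  else forall x, U x -> {for x, continuous g}.

(* [None] stands for the exponent infinity. *)
Definition Ck_on (R : realType) (V W : normedModType R) (k : option nat)
    (U : set V) (g : V -> W) : Prop :=
  if k is Some n then Cn_on n U g else forall n, Cn_on n U g.

Definition topological_embedding (X Y : topologicalType) (A : set X)
    (h : X -> Y) : Prop :=
  [/\ {within A, continuous h},
      {in A &, injective h} &
      forall U, open U -> exists2 V, open V & A `&` U = A `&` h @^-1` V].

Definition null_homotopic_in (R : realType) (X Y : topologicalType)
    (A : set X) (Z : set Y) (g : X -> Y) : Prop :=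
  exists H : X * R -> Y,
    [/\ {within A `*` `[0, 1], continuous H},
        (forall u t, A u -> 0 <= t <= 1 -> Z (H (u, t))),
        (forall u, A u -> H (u, 0) = g u) &
        exists c, forall u, A u -> H (u, 1) = c].

Section EuclideanSubsets.
Variable R : realType.

(* The norm of ['rV[R]_3] in the library is the sup norm, hence the sums of
   squares. *)
Definition open_ball3 : set 'rV[R]_3 := [set u | \sum_j u 0 j ^+ 2 < 1].
Definition closed_ball3 : set 'rV[R]_3 := [set u | \sum_j u 0 j ^+ 2 <= 1].
Definition sphere2 : set 'rV[R]_3 := [set u | \sum_j u 0 j ^+ 2 = 1].

End EuclideanSubsets.

Arguments open_ball3 R : clear implicits.
Arguments closed_ball3 R : clear implicits.
Arguments sphere2 R : clear implicits.

(* An open subset which is the interior of an embedded closed 3-ball; its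
   topological boundary is then the image of the unit sphere. *)
Definition embedded_open_ball (R : realType) (M : topologicalType)
    (B : set M) : Prop :=
  open B /\
  exists2 phi : 'rV[R]_3 -> M,
    topological_embedding (closed_ball3 R) phi &
    B = phi @` open_ball3 R.

Definition topological_boundary (T : topologicalType) (A : set T) : set T :=
  closure A `\` A°.

(* The Grassmannian of k-dimensional linear subspaces of R^n, with the quotient
   topology for the map sending a k-frame (the rows of a k x n matrix of rank
   k) to its span. *)
Section Grassmannian.
Variables (R : realType) (n k : nat).

Definition grassmannian : Type := {P : {vspace 'rV[R]_n} | \dim P == k}.

HB.instance Definition _ := Choice.on grassmannian.

Definition row_span (A : 'M[R]_(k, n)) : {vspace 'rV[R]_n} :=
  limg (linfun (mulmxr A : 'rV[R]_k -> 'rV[R]_n)).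

Definition frames_of (U : set grassmannian) : set 'M[R]_(k, n) :=
  [set A | row_free A /\ exists2 P, U P & sval P = row_span A].

(* [frames_of U] is relatively open in the set of frames. *)
Definition grassmannian_open (U : set grassmannian) : Prop :=
  forall A, frames_of U A -> \forall B \near A, row_free B -> frames_of U B.

Lemma row_span_dim (A : 'M[R]_(k, n)) : row_free A -> \dim (row_span A) == k.
Proof.
move=> fA; rewrite limg_dim_eq ?dimvf ?mul1n //.
  by rewrite /dim /= mul1n.
apply/eqP; rewrite capfv -subv0; apply/subvP => v; rewrite memv_ker lfunE /=.
rewrite memv0 => /eqP vA0; apply/eqP; apply: (row_free_inj fA).
by rewrite vA0 mul0mx.
Qed.

Let grassmannian_openT : grassmannian_open setT.
Proof.
move=> A _; near=> B => fB; split=> //.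
by exists (exist _ (row_span B) (row_span_dim fB)).
Unshelve. all: by end_near. Qed.

Let grassmannian_openI : setI_closed grassmannian_open.
Proof.
move=> U V oU oV A [fA [P [UP VP] PA]].
have := oU A (conj fA (ex_intro2 _ _ P UP PA)).
have := oV A (conj fA (ex_intro2 _ _ P VP PA)).
apply: filterS2 => B hV hU fB; split=> //.
have [_ [Q VQ QB]] := hV fB; have [_ [Q' UQ' Q'B]] := hU fB.
exists Q => //; split=> //.
by rewrite (_ : Q = Q') //; apply/val_inj; rewrite /= QB Q'B.
Qed.

Let grassmannian_open_bigU (I : Type) (F : I -> set grassmannian) :
  (forall i, grassmannian_open (F i)) -> grassmannian_open (\bigcup_i F i).
Proof.
move=> oF A [fA [P [i _ FiP] PA]].
have := oF i A (conj fA (ex_intro2 _ _ P FiP PA)).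
apply: filterS => B h fB; have [_ [Q FQ QB]] := h fB.
by split=> //; exists Q => //; exists i.
Qed.

HB.instance Definition _ := isOpenTopological.Build grassmannian
  grassmannian_openT grassmannian_openI grassmannian_open_bigU.

End Grassmannian.

Section ComplexStructure.
Variable R : realType.

(* Multiplication by i: (x, y) |-> (-y, x). *)
Definition Jmul : 'End('rV[R]_(3 + 3)) :=
  linfun (mulmxr (block_mx 0 1%:M (- 1%:M) 0 : 'M[R]_(3 + 3))).

Definition totally_real (P : {vspace 'rV[R]_(3 + 3)}) : Prop :=
  (P :&: (Jmul @: P) = 0)%VS.

Definition totally_real_planes : set (grassmannian R (3 + 3) 3) :=
  [set P | totally_real (sval P)].

End ComplexStructure.

Arguments totally_real_planes R : clear implicits.

(* [chart_fwd] and [chart_bwd] are only meaningful on [chart_dom] and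
   [chart_cod]. *)
Record chart3 (R : realType) (M : topologicalType) := Chart3 {
  chart_dom : set M;
  chart_cod : set 'rV[R]_3;
  chart_fwd : M -> 'rV[R]_3;
  chart_bwd : 'rV[R]_3 -> M;
  chart_dom_open : open chart_dom;
  chart_cod_open : open chart_cod;
  chart_fwd_cod : forall p, chart_dom p -> chart_cod (chart_fwd p);
  chart_bwd_dom : forall u, chart_cod u -> chart_dom (chart_bwd u);
  chart_fwdK : forall p, chart_dom p -> chart_bwd (chart_fwd p) = p;
  chart_bwdK : forall u, chart_cod u -> chart_fwd (chart_bwd u) = u;
  chart_fwd_continuous : {within chart_dom, continuous chart_fwd};
  chart_bwd_continuous : {within chart_cod, continuous chart_bwd}
}.

Definition transition (R : realType) (M : topologicalType)
    (c d : chart3 R M) : 'rV[R]_3 -> 'rV[R]_3 :=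
  chart_fwd d \o chart_bwd c.

Definition transition_dom (R : realType) (M : topologicalType)
    (c d : chart3 R M) : set 'rV[R]_3 :=
  chart_cod c `&` chart_bwd c @^-1` chart_dom d.

(* The orientation is given by the atlas itself, through [atlas_oriented];
   [atlas_at] selects the chart in which the differential at a point is
   computed. *)
Record oriented_atlas3 (R : realType) (M : topologicalType) := OrientedAtlas3 {
  atlas_index : Type;
  atlas_chart : atlas_index -> chart3 R M;
  atlas_at : M -> atlas_index;
  atlas_atP : forall p, chart_dom (atlas_chart (atlas_at p)) p;
  atlas_smooth : forall a b,
    Ck_on None (transition_dom (atlas_chart a) (atlas_chart b))
               (transition (atlas_chart a) (atlas_chart b));
  atlas_oriented : forall a b u,
    transition_dom (atlas_chart a) (atlas_chart b) u ->
    0 < \det ('J (transition (atlas_chart a) (atlas_chart b)) u)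
}.

Definition closed_space (M : topologicalType) : Prop :=
  [/\ hausdorff_space M, second_countable (T := M) & compact [set: M]].

Section MapsToC3.
Variables (R : realType) (M : topologicalType) (X : oriented_atlas3 R M).
Implicit Types (f : M -> 'rV[R]_(3 + 3)) (k : option nat).

Definition Ck_map k f : Prop :=
  forall a : atlas_index X,
    Ck_on k (chart_cod (atlas_chart a)) (f \o chart_bwd (atlas_chart a)).

(* The linear subspace df_p(T_pM) of C^3. *)
Definition tangent_image f (p : M) : {vspace 'rV[R]_(3 + 3)} :=
  let c := atlas_chart (atlas_at X p) in
  limg (linfun ('d (f \o chart_bwd c) (chart_fwd c p))).

Definition Ck_embedding k f : Prop :=
  [/\ Ck_map k f,
      (forall p, \dim (tangent_image f p) = 3%N) &
      topological_embedding [set: M] f].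

Definition is_gauss_map f (G : M -> grassmannian R (3 + 3) 3) : Prop :=
  forall p, sval (G p) = tangent_image f p.

Definition complex_tangents f : set M :=
  [set p | ~ totally_real (tangent_image f p)].

Definition removable_in k f (B : set M) : Prop :=
  exists g : M -> 'rV[R]_(3 + 3),
    [/\ Ck_embedding k g,
        (forall p, ~ B p -> g p = f p) &
        (forall p, B p -> ~ complex_tangents g p)].

End MapsToC3.

(* Main.v *)
Require Import Defs.
From HB Require Import structures.
From mathcomp Require Import all_boot all_order all_algebra.
From mathcomp Require Import all_classical all_reals all_analysis.
From mathcomp Require Import ring lra.
Set Implicit Arguments.
Unset Strict Implicit.
Unset Printing Implicit Defensive.
Import Order.TTheory GRing.Theory Num.Theory.
Import numFieldNormedType.Exports.
Local Open Scope classical_set_scope.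
Local Open Scope ring_scope.

(* Let [g] be the embedding that removes [x].  Its Gauss map is totally real on
   the closed ball, so contracting the ball to its centre contracts the Gauss
   map of [g] on the boundary sphere.  It remains to see that [df = dg] on that
   sphere.  Both differentials are continuous and agree on the exterior of the
   ball, so this holds as soon as the sphere lies in the closure of the
   exterior.  As the ball is only topologically embedded, this is invariance of
   the boundary: if a boundary point [p] were interior to the closed ball, then
   moving each point of a small cube around [p] slightly towards the centre of
   the ball would give a map of the cube close to the identity that misses [p],
   contradicting the Poincare-Miranda theorem.  The latter is obtained from a
   discrete Stokes formula for the cup product dx u dy u dz of 0/1-valued
   functions on a grid. *)

(** * The Poincare-Miranda theorem in dimension 3 *)

(* The cup product dy u dz of 0-cochains, summed with signs over the two
   monotone edge paths from (i, j) to (i+1, j+1). *)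
Definition dcup2 (y z : nat -> nat -> int) i j : int :=
  (y i.+1 j - y i j) * (z i.+1 j.+1 - z i.+1 j)
  - (y i j.+1 - y i j) * (z i.+1 j.+1 - z i j.+1).

(** Since dy u dz = d(y u dz), the sum telescopes to the boundary of the square. The terms [b']
    vanish where j is 0 or n, because z is constant there. The terms [b] vanish at i = 0, where y =
    0, and at i = n they leave the total increment of z along an edge, which is 1. *)
Lemma sum_dcup2 (y z : nat -> nat -> int) n :
  (forall j, (j <= n)%N -> y 0%N j = 0 /\ y n j = 1) ->
  (forall i, (i <= n)%N -> z i 0%N = 0 /\ z i n = 1) ->
  \sum_(0 <= i < n) \sum_(0 <= j < n) dcup2 y z i j = 1.
Proof.
move=> hy hz.
pose b i j := y i j * (z i j.+1 - z i j).
pose b' i j := y i j * (z i.+1 j - z i j).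
transitivity (\sum_(0 <= j < n) \sum_(0 <= i < n) (b i.+1 j - b i j)
   - \sum_(0 <= i < n) \sum_(0 <= j < n) (b' i j.+1 - b' i j)).
  rewrite [X in _ = X - _]exchange_big /= -sumrB; apply: eq_bigr => i _.
  by rewrite -sumrB; apply: eq_bigr => j _; rewrite /dcup2 /b /b'; ring.
have -> : \sum_(0 <= i < n) \sum_(0 <= j < n) (b' i j.+1 - b' i j) = 0.
  rewrite big_nat big1// => i /= ltin; rewrite telescope_sumr// /b'.
  have [-> ->] := hz _ (ltnW ltin); have [-> ->] := hz _ ltin; ring.
rewrite subr0 big_nat (eq_bigr (fun j => z n j.+1 - z n j)).
  by rewrite -big_nat telescope_sumr//; have [-> ->] := hz _ (leqnn n).
move=> j /= ltjn; rewrite telescope_sumr// /b.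
by have [-> ->] := hy _ (ltnW ltjn); ring.
Qed.

Section Cup3.
Variables x y z : nat -> nat -> nat -> int.

(* dx u dy u dz summed with signs over the six monotone edge paths across the
   cell, i.e. over the simplices of Kuhn's triangulation of the cube. *)
Definition dcup3 i j k : int :=
    (x i.+1 j k - x i j k) *
      ((y i.+1 j.+1 k - y i.+1 j k) * (z i.+1 j.+1 k.+1 - z i.+1 j.+1 k)
       - (y i.+1 j k.+1 - y i.+1 j k) * (z i.+1 j.+1 k.+1 - z i.+1 j k.+1))
  - (x i j.+1 k - x i j k) *
      ((y i.+1 j.+1 k - y i j.+1 k) * (z i.+1 j.+1 k.+1 - z i.+1 j.+1 k)
       - (y i j.+1 k.+1 - y i j.+1 k) * (z i.+1 j.+1 k.+1 - z i j.+1 k.+1))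
  + (x i j k.+1 - x i j k) *
      ((y i.+1 j k.+1 - y i j k.+1) * (z i.+1 j.+1 k.+1 - z i.+1 j k.+1)
       - (y i j.+1 k.+1 - y i j k.+1) * (z i.+1 j.+1 k.+1 - z i j.+1 k.+1)).

Let b1 i j k := x i j k * dcup2 (y i) (z i) j k.
Let b2 i j k := x i j k * dcup2 (fun i => y i j) (fun i => z i j) i k.
Let b3 i j k := x i j k * dcup2 (fun i j => y i j k) (fun i j => z i j k) i j.

(* d(x u dy u dz) = dx u dy u dz. *)
Lemma dcup3E i j k : dcup3 i j k =
  (b1 i.+1 j k - b1 i j k) - (b2 i j.+1 k - b2 i j k)
  + (b3 i j k.+1 - b3 i j k).
Proof. rewrite /dcup3 /b1 /b2 /b3 /dcup2; ring. Qed.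

(** Discrete Stokes: by [dcup3E] only the faces of the cube contribute. On the y-faces y is constant
    and on the z-faces z is constant, so their cup products vanish. The face x = 0 carries the
    factor 0, and the face x = 1 reduces to [sum_dcup2]. *)
Lemma sum_dcup3 n :
  (forall j k, (j <= n)%N -> (k <= n)%N -> x 0%N j k = 0 /\ x n j k = 1) ->
  (forall i k, (i <= n)%N -> (k <= n)%N -> y i 0%N k = 0 /\ y i n k = 1) ->
  (forall i j, (i <= n)%N -> (j <= n)%N -> z i j 0%N = 0 /\ z i j n = 1) ->
  \sum_(0 <= i < n) \sum_(0 <= j < n) \sum_(0 <= k < n) dcup3 i j k = 1.
Proof.
move=> hx hy hz.
transitivity (
     \sum_(0 <= j < n) \sum_(0 <= k < n) \sum_(0 <= i < n)
       (b1 i.+1 j k - b1 i j k)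
   - \sum_(0 <= i < n) \sum_(0 <= k < n) \sum_(0 <= j < n)
       (b2 i j.+1 k - b2 i j k)
   + \sum_(0 <= i < n) \sum_(0 <= j < n) \sum_(0 <= k < n)
       (b3 i j k.+1 - b3 i j k)).
  under [X in _ = X - _ + _]eq_bigr do rewrite exchange_big.
  rewrite [X in _ = X - _ + _]exchange_big /= -sumrB -big_split /=.
  apply: eq_bigr => i _.
  rewrite [X in _ = _ - X + _]exchange_big /= -sumrB -big_split /=.
  apply: eq_bigr => j _.
  by rewrite -sumrB -big_split; apply: eq_bigr => k _; rewrite dcup3E.
have -> : \sum_(0 <= i < n) \sum_(0 <= k < n) \sum_(0 <= j < n)
    (b2 i j.+1 k - b2 i j k) = 0.
  rewrite big_nat big1// => i /= ltin; rewrite big_nat big1// => k /= ltkn.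
  rewrite telescope_sumr// /b2 /dcup2.
  have [-> ->] := hy _ _ (ltnW ltin) (ltnW ltkn).
  have [-> ->] := hy _ _ ltin (ltnW ltkn).
  by have [-> ->] := hy _ _ (ltnW ltin) ltkn; ring.
have -> : \sum_(0 <= i < n) \sum_(0 <= j < n) \sum_(0 <= k < n)
    (b3 i j k.+1 - b3 i j k) = 0.
  rewrite big_nat big1// => i /= ltin; rewrite big_nat big1// => j /= ltjn.
  rewrite telescope_sumr// /b3 /dcup2.
  have [-> ->] := hz _ _ ltin ltjn.
  have [-> ->] := hz _ _ ltin (ltnW ltjn).
  by have [-> ->] := hz _ _ (ltnW ltin) ltjn; ring.
rewrite subr0 addr0 -(@sum_dcup2 (y n) (z n) n).
- rewrite big_nat [in RHS]big_nat; apply: eq_bigr => j /= ltjn.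
  rewrite big_nat [in RHS]big_nat; apply: eq_bigr => k /= ltkn.
  rewrite telescope_sumr// /b1.
  by have [-> ->] := hx _ _ (ltnW ltjn) (ltnW ltkn); ring.
- by move=> k lekn; exact: hy.
- by move=> j lejn; exact: hz.
Qed.

Definition cell_constant (x : nat -> nat -> nat -> int) i j k :=
  forall a b c : bool, x (a + i)%N (b + j)%N (c + k)%N = x i j k.

(** Each of the six products in [dcup3] contains one increment of x, one of y and one of z along
    edges of the cell. If one label were constant on each cell, all terms would vanish, whereas
    their sum is 1. *)
Lemma nonconstant_cell n :
  (forall j k, (j <= n)%N -> (k <= n)%N -> x 0%N j k = 0 /\ x n j k = 1) ->
  (forall i k, (i <= n)%N -> (k <= n)%N -> y i 0%N k = 0 /\ y i n k = 1) ->
  (forall i j, (i <= n)%N -> (j <= n)%N -> z i j 0%N = 0 /\ z i j n = 1) ->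
  ~ forall i j k, (i < n)%N -> (j < n)%N -> (k < n)%N ->
    [\/ cell_constant x i j k, cell_constant y i j k | cell_constant z i j k].
Proof.
move=> hx hy hz cst; have := sum_dcup3 hx hy hz.
rewrite big_nat big1 ?(rwP eqP)// => i /= ltin.
rewrite big_nat big1// => j /= ltjn; rewrite big_nat big1// => k /= ltkn.
rewrite /dcup3; have [h|h|h] := cst _ _ _ ltin ltjn ltkn;
  have := (h true false false, h false true false, h false false true,
           h true true false, h true false true, h false true true,
           h true true true);
  rewrite /= !add0n !add1n => e; rewrite !e; ring.
Qed.

End Cup3.

(** * From grid labels to continuous maps of the cube *)

Definition cube (R : realType) (a : 'rV[R]_3) (r : R) : set 'rV[R]_3 :=
  [set u | forall l, `[a ord0 l - r, a ord0 l + r]%classic (u ord0 l)].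

Lemma cube_compact (R : realType) (a : 'rV[R]_3) r : compact (cube a r).
Proof.
apply: (@rV_compact _ _ (fun l => `[a ord0 l - r, a ord0 l + r]%classic)) => l.
exact: segment_compact.
Qed.

Section PoincareMiranda.
Variables (R : realType) (a : 'rV[R]_3) (r : R) (f : 'rV[R]_3 -> 'rV[R]_3).
Hypothesis r_gt0 : 0 < r.
Hypothesis f_cont : {within cube a r, continuous f}.
Hypothesis f_le0 : forall u l, cube a r u ->
  u ord0 l = a ord0 l - r -> f u ord0 l <= 0.
Hypothesis f_gt0 : forall u l, cube a r u ->
  u ord0 l = a ord0 l + r -> 0 < f u ord0 l.

(* With a mesh of 2r/(N+1), the neighbours of a grid point lie in this ball. *)
Let constant_sign (N : nat) (u : 'rV[R]_3) := exists l, forall v,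
  cube a r v -> ball u (3 * r * N.+1%:R^-1) v ->
  (0 < f v ord0 l) = (0 < f u ord0 l).

(** A coordinate of [f] that is nonzero at [u] keeps its sign nearby. The joint neighbourhood in
    [u'] and [N] is the form from which compactness extracts a uniform [N]. *)
Let constant_sign_near u : cube a r u -> f u != 0 ->
  \forall u' \near u & N \near \oo, cube a r u' -> constant_sign N u'.
Proof.
move=> Qu fu0; have [l fl0] : exists l, f u ord0 l != 0.
  apply/existsP; apply: contraR fu0; rewrite negb_exists => /forallP h.
  by apply/eqP/rowP => l; rewrite mxE; apply/eqP; have := h l; rewrite negbK.
have sgn : \forall v \near u, cube a r v ->
    (0 < f v ord0 l) = (0 < f u ord0 l).
  move/subspace_continuousP: f_cont => /(_ u Qu) fcu.
  have : (fun v => f v ord0 l) @ within (cube a r) (nbhs u) --> f u ord0 l.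
    exact: (cvg_comp _ _ fcu (@coord_continuous _ _ _ ord0 l _)).
  have [fl_gt0|fl_le0] := ltP 0 (f u ord0 l).
    by move/cvgr_gt => /(_ _ fl_gt0).
  have {fl0}fl_lt0 : f u ord0 l < 0 by rewrite lt_neqAle fl0.
  move/cvgr_lt => /(_ _ fl_lt0); apply: filterS => v fv.
  by rewrite ltNge (ltW fv).
have /nbhs_ballP[e /= e0 he] := sgn.
(* Half of [e] bounds the distance from [u] to [u'], the other half the distance from [u'] to
   [v]. *)
exists (ball u (e / 2), [set N | 3 * r * N.+1%:R^-1 < e / 2]).
  split => /=; first by apply: nbhsx_ballx; lra.
  have r3 : 0 < 3 * r by rewrite mulr_gt0.
  have d0 : 0 < e / 2 / (3 * r) by rewrite !divr_gt0.
  have := near_infty_natSinv_lt (PosNum d0); apply: filterS => N /= hN.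
  by rewrite mulrC -ltr_pdivlMr.
move=> [u' N] /= [uu' hN] Qu'; exists l => v Qv u'v.
rewrite he //; first by rewrite he//; apply: le_ball uu'; lra.
rewrite (splitr e); apply: ball_triangle uu' _.
by apply: le_ball u'v; exact: ltW.
Qed.

(** Label a grid point by the positivity of each coordinate of [f]. The hypotheses on the faces give
    the boundary labels 0 and 1. Without a zero, a fine enough grid would have a constant label on
    every cell, against [nonconstant_cell]. *)
Lemma poincare_miranda : exists2 u, cube a r u & f u = 0.
Proof.
apply: contrapT => nz.
have hn : \forall N \near \oo, cube a r `<=` constant_sign N.
  move: (@cube_compact R a r) => /compact_near_coveringP/near_covering_withinP.
  apply => u Qu; apply: constant_sign_near => //.
  by apply/eqP => fu0; apply: nz; exists u.
have [N hN] := filter_ex hn.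
set n := N.+1 in hN; have n0 : 0 < n%:R :> R by rewrite ltr0n.
pose h : R := 2 * r * n%:R^-1.
have hE : h * n%:R = 2 * r by rewrite /h; field; rewrite lt0r_neq0.
have h0 : 0 < h by rewrite !mulr_gt0 // invr_gt0.
pose pt (i j k : nat) : 'rV[R]_3 :=
  \row_l (a ord0 l - r + h * (nth 0%N [:: i; j; k] l)%:R).
have ptE i j k (l : 'I_3) :
  pt i j k ord0 l = a ord0 l - r + h * (nth 0%N [:: i; j; k] l)%:R.
  by rewrite mxE.
have Qpt i j k : (i <= n)%N -> (j <= n)%N -> (k <= n)%N -> cube a r (pt i j k).
  move=> lin ljn lkn l; rewrite ptE /= in_itv /=.
  have : (nth 0%N [:: i; j; k] l <= n)%N by case: l => [[|[|[|]]]].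
  rewrite -(ler_nat R) -(ler_pM2l h0) hE => ub.
  have : 0 <= h * (nth 0%N [:: i; j; k] l)%:R by rewrite mulr_ge0 // ltW.
  by move=> lb; apply/andP; split; lra.
pose lab (l : 'I_3) i j k : int := nat_of_bool (0 < f (pt i j k) ord0 l).
pose o0 : 'I_3 := @Ordinal 3 0 isT; pose o1 : 'I_3 := @Ordinal 3 1 isT.
pose o2 : 'I_3 := @Ordinal 3 2 isT.
have lab0 (l : 'I_3) i j k : (i <= n)%N -> (j <= n)%N -> (k <= n)%N ->
    nth 0%N [:: i; j; k] l = 0%N -> lab l i j k = 0.
  move=> lin ljn lkn nl; rewrite /lab ltNge f_le0 //; first exact: Qpt.
  by rewrite ptE nl mulr0 addr0.
have lab1 (l : 'I_3) i j k : (i <= n)%N -> (j <= n)%N -> (k <= n)%N ->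
    nth 0%N [:: i; j; k] l = n -> lab l i j k = 1.
  move=> lin ljn lkn nl; rewrite /lab f_gt0 //; first exact: Qpt.
  by rewrite ptE nl hE; lra.
apply: (@nonconstant_cell (lab o0) (lab o1) (lab o2) n).
- by move=> j k ljn lkn; split; [apply: lab0|apply: lab1].
- by move=> i k lin lkn; split; [apply: lab0|apply: lab1].
- by move=> i j lin ljn; split; [apply: lab0|apply: lab1].
move=> i j k ltin ltjn ltkn.
have [l hl] := hN _ (Qpt _ _ _ (ltnW ltin) (ltnW ltjn) (ltnW ltkn)).
have {}hl : cell_constant (lab l) i j k.
  move=> b c d; rewrite /lab hl //.
    by apply: Qpt; [case: b|case: c|case: d]; rewrite ?add0n ?add1n // ltnW.
  split=> [|i0 m]; first by rewrite !mulr_gt0 ?invr_gt0.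
  rewrite !ord1 !ptE /ball /= opprD addrACA subrr add0r -mulrBr -/n.
  (* Balls are open and a neighbour can be at sup distance exactly [h], hence the factor 3 in the
     radius against 2 in the mesh. *)
  have h32 : h < 3 * r * n%:R^-1.
    by rewrite /h ltr_pM2r ?invr_gt0 // ltr_pM2r // ltr_nat.
  apply: le_lt_trans h32; rewrite normrM (gtr0_norm h0) ler_piMr //; first exact: ltW.
  case: m => [[|[|[|//]]] ?] /=; rewrite distrC natrD addrK;
    rewrite ger0_norm ?ler0n // lern1; [by case: b|by case: c|by case: d].
have [lE|lE|lE] : [\/ l = o0, l = o1 | l = o2].
- by case: l {hl} => [[|[|[|//]]] ?]; [apply: Or31|apply: Or32|apply: Or33];
    apply: val_inj.
- by apply: Or31; rewrite -lE.
- by apply: Or32; rewrite -lE.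
- by apply: Or33; rewrite -lE.
Qed.

End PoincareMiranda.

(** * Gauss maps of C^1 immersions *)

Lemma within_continuous_comp_sub (X Y Z : topologicalType) (A : set X)
    (C : set Y) (f : X -> Y) (g : Y -> Z) :
  {within A, continuous f} -> {within C, continuous g} -> f @` A `<=` C ->
  {within A, continuous (g \o f)}.
Proof.
move=> /subspace_continuousP cf /subspace_continuousP cg AC.
apply/subspace_continuousP => x Ax W /= /(cg _ (AC _ (imageP f Ax))) /= CW.
have := cf x Ax _ CW; apply: filterS2 (withinT _ _) => y Ay.
by apply; apply: AC; exact: imageP.
Qed.

Section RowSpan.
Variables (R : realType) (n k : nat).

Lemma row_spanM (A : 'M[R]_k) (B : 'M[R]_(k, n)) :
  (row_span (A *m B) <= row_span B)%VS.
Proof.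
apply/subvP => _ /memv_imgP[v _ ->]; rewrite lfunE /= mulmxA.
apply/memv_imgP; exists (v *m A); first exact: memvf.
by rewrite lfunE.
Qed.

Lemma dim_row_span_le (B : 'M[R]_(k, n)) : (\dim (row_span B) <= k)%N.
Proof.
have := limg_ker_dim (linfun (mulmxr B : 'rV[R]_k -> 'rV[R]_n)) fullv.
rewrite -/(row_span B) dimvf /dim /= mul1n => E.
exact: leq_trans (leq_addl _ _) (eq_leq E).
Qed.

Lemma row_free_row_span (B : 'M[R]_(k, n)) :
  \dim (row_span B) = k -> row_free B.
Proof.
move=> dB; apply: inj_row_free => v vB0.
have := limg_ker_dim (linfun (mulmxr B : 'rV[R]_k -> 'rV[R]_n)) fullv.
rewrite -/(row_span B) dB dimvf /dim /= mul1n capfv -[X in _ = X]add0n.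
move/addIn/eqP; rewrite dimv_eq0 => /eqP k0.
by apply/eqP; rewrite -memv0 -k0 memv_ker lfunE /= vB0.
Qed.

End RowSpan.

(** * Jacobian matrices of C^k maps *)

Lemma limg_differential (R : realType) m n (g : 'rV[R]_m -> 'rV[R]_n) y :
  limg (linfun ('d g y)) = row_span ('J g y).
Proof.
by congr (limg _); apply/lfunP => v; rewrite !lfunE /= mul_rV_lin1.
Qed.

Lemma Ck_on_differentiable (R : realType) (V W : normedModType R) k (U : set V)
    (g : V -> W) : k <> Some 0%N -> Ck_on k U g ->
  forall x, U x -> differentiable g x.
Proof.
by case: k => [[//|n]|] _ => [|/(_ 1%N)] [].
Qed.

Lemma Ck_on_continuous_derive (R : realType) (V W : normedModType R) k
    (U : set V) (g : V -> W) : k <> Some 0%N -> Ck_on k U g ->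
  forall v x, U x -> {for x, continuous ('D_v g)}.
Proof.
case: k => [[//|n]|] _ => [[_ + v x Ux]|/(_ 1%N)/= [] //].
by move=> /(_ v); case: n => [|n] /= => [|[+ _]] => /(_ x Ux) // /differentiable_continuous.
Qed.

Lemma cvg_mx (R : realFieldType) m n (T : Type) (F : set_system T) {FF : Filter F}
    (f : T -> 'M[R]_(m, n)) (A : 'M[R]_(m, n)) :
  (forall i j, (fun t => f t i j) @ F --> A i j) -> f @ F --> A.
Proof.
move=> h; apply/cvg_ballP => e e0.
have : \forall t \near F, forall ij : 'I_m * 'I_n,
    ball (A ij.1 ij.2) e (f t ij.1 ij.2).
  by apply: filter_forall => -[i j] /=; have /cvg_ballP := h i j; apply.
by apply: filterS => t ht; split=> // i j; exact: (ht (i, j)).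
Qed.

Lemma Ck_on_continuous_jacobian (R : realType) m n k (U : set 'rV[R]_m)
    (g : 'rV[R]_m -> 'rV[R]_n) : open U -> k <> Some 0%N -> Ck_on k U g ->
  forall x, U x -> {for x, continuous (fun y => 'J g y)}.
Proof.
move=> oU k0 gk x Ux; apply: (@cvg_mx _ _ _ _ (nbhs x) _) => i j.
pose D := 'D_(delta_mx 0 i) g.
have JE y : U y -> 'J g y i j = D y 0 j.
  move=> Uy; rewrite /D deriveEjacobian; last exact: Ck_on_differentiable k0 gk _ Uy.
  by rewrite -rowE [RHS]mxE.
(* Only the limit is rewritten here: the two functions agree on [U], hence merely near [x]. *)
apply: (eq_rect_r (fun z => (fun y => 'J g y i j) @ x --> z) _ (JE x Ux)).
have cD : (fun y => D y 0 j) @ x --> D x 0 j.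
  exact: (cvg_comp _ _ (Ck_on_continuous_derive k0 gk Ux) (@coord_continuous _ _ _ 0 j _)).
have nJ : \forall y \near nbhs x, D y 0 j = 'J g y i j.
  have nU : \forall y \near x, U y by exact: open_nbhs_nbhs.
  by apply: filterS nU => y Uy; symmetry; exact: JE.
exact: (cvg_trans (near_eq_cvg nJ) cD).
Qed.

Lemma row_jacobian (R : realType) m n (g : 'rV[R]_m -> 'rV[R]_n) x i :
  differentiable g x -> row i ('J g x) = 'D_(delta_mx 0 i) g x.
Proof. by move=> dg; rewrite rowE -deriveEjacobian. Qed.

Lemma near_eq_jacobian (R : realType) m n (g h : 'rV[R]_m -> 'rV[R]_n) x :
  differentiable g x -> differentiable h x -> {near x, g =1 h} ->
  'J g x = 'J h x.
Proof.
move=> dg dh gh; apply/row_matrixP => i.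
apply: etrans (row_jacobian i dg) (etrans _ (esym (row_jacobian i dh))).
exact: near_eq_derive.
Qed.

Lemma jacobian_comp (R : realType) l m n (T : 'rV[R]_l -> 'rV[R]_m)
    (h : 'rV[R]_m -> 'rV[R]_n) x :
  differentiable T x -> differentiable h (T x) ->
  'J (h \o T) x = 'J T x *m 'J h (T x).
Proof.
move=> dT dh; apply/row_matrixP => i; rewrite row_mul.
have dhT := differentiable_comp dT dh.
apply: etrans (row_jacobian i dhT) (etrans _
  (congr1 (mulmx^~ _) (esym (row_jacobian i dT)))).
apply: etrans (deriveE _ dhT) (etrans _ (deriveEjacobian _ dh)).
by rewrite diff_comp // (deriveE _ dh) (deriveE _ dT).
Qed.

(** * The Gauss map in charts *)

Section GaussMap.
Variables (R : realType) (M : topologicalType) (X : oriented_atlas3 R M).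
Variables (k : option nat) (k_ge1 : k <> Some 0%N).
Implicit Types (f g : M -> 'rV[R]_(3 + 3)) (p : M).
Local Notation chart := (atlas_chart (o := X)).

Lemma chart_fwd_continuous_at (c : chart3 R M) p :
  chart_dom c p -> {for p, continuous (chart_fwd c)}.
Proof.
move=> cp; have := @chart_fwd_continuous _ _ c.
rewrite continuous_open_subspace; last exact: chart_dom_open.
by apply; exact: mem_set.
Qed.

Lemma chart_bwd_continuous_at (c : chart3 R M) u :
  chart_cod c u -> {for u, continuous (chart_bwd c)}.
Proof.
move=> cu; have := @chart_bwd_continuous _ _ c.
rewrite continuous_open_subspace; last exact: chart_cod_open.
by apply; exact: mem_set.
Qed.

(** The chain rule, since f read in chart c is, near the point, f read in chart b composed with the
    transition map. *)
Lemma jacobian_transition f (fk : Ck_map X k f) (b c : atlas_index X) p :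
  chart_dom (chart b) p -> chart_dom (chart c) p ->
  'J (f \o chart_bwd (chart c)) (chart_fwd (chart c) p) =
  'J (transition (chart c) (chart b)) (chart_fwd (chart c) p) *m
  'J (f \o chart_bwd (chart b)) (chart_fwd (chart b) p).
Proof.
move=> bp cp; set x := chart_fwd (chart c) p; set T := transition _ _.
set gb := f \o chart_bwd (chart b); set gc := f \o chart_bwd (chart c).
have cx : chart_cod (chart c) x by exact: chart_fwd_cod.
have Tx : T x = chart_fwd (chart b) p by rewrite /T /transition /= chart_fwdK.
have dT : differentiable T x.
  have [] := @atlas_smooth _ _ X c b 1%N; move=> + _; apply.
  by split => //=; rewrite /x chart_fwdK.
have dgb : differentiable gb (T x).
  by apply: (Ck_on_differentiable k_ge1 (fk b)); rewrite Tx; exact: chart_fwd_cod.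
have dgc : differentiable gc x by exact: (Ck_on_differentiable k_ge1 (fk c)).
have gcE : \forall y \near x, gc y = (gb \o T) y.
  have : \forall y \near x, chart_dom (chart b) (chart_bwd (chart c) y).
    apply: (chart_bwd_continuous_at cx).
    apply: open_nbhs_nbhs; split; first exact: chart_dom_open.
    by rewrite /x chart_fwdK.
  by apply: filterS => y by_; rewrite /gc /gb /T /transition /= chart_fwdK.
have dgT : differentiable (gb \o T) x by exact: differentiable_comp.
by rewrite -Tx; exact: etrans (near_eq_jacobian dgc dgT gcE) (jacobian_comp dT dgb).
Qed.

Lemma tangent_imageE f p : let c := chart (atlas_at X p) in
  tangent_image X f p = row_span ('J (f \o chart_bwd c) (chart_fwd c p)).
Proof. exact: limg_differential. Qed.

(** The chart selected by [atlas_at] may vary wildly with the point; this permits working in one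
    fixed chart near a given point. The change of chart gives an inclusion of row spans, and
    dimension 3 forces equality. *)
Lemma tangent_image_chart f (fk : Ck_map X k f) (b : atlas_index X) p :
  \dim (tangent_image X f p) = 3%N -> chart_dom (chart b) p ->
  let J := 'J (f \o chart_bwd (chart b)) (chart_fwd (chart b) p) in
  row_free J /\ tangent_image X f p = row_span J.
Proof.
move=> d3 bp J; move: d3; rewrite tangent_imageE.
rewrite (jacobian_transition fk bp (atlas_atP X p)) -/J.
set A := 'J _ _ => d3; have AJ := row_spanM A J.
have eqAJ : row_span (A *m J) = row_span J.
  by apply/eqP; rewrite eqEdim AJ d3 dim_row_span_le.
by split=> //; apply: row_free_row_span; rewrite -eqAJ.
Qed.

Definition gauss f (f_imm : forall p, \dim (tangent_image X f p) = 3%N) p :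
    grassmannian R (3 + 3) 3 :=
  exist _ (tangent_image X f p) (introT eqP (f_imm p)).

(** In a fixed chart the Jacobian is a frame of the tangent image that depends continuously on the
    point, and open sets of planes are by definition those whose frames form a relatively open
    set. *)
Lemma gauss_continuous f (fk : Ck_map X k f)
    (f_imm : forall p, \dim (tangent_image X f p) = 3%N) :
  continuous (gauss f_imm).
Proof.
move=> p W /=; rewrite nbhsE => -[U [oU Up] UW].
set c := chart (atlas_at X p); have cp : chart_dom c p := atlas_atP X p.
have [rfp tp] := tangent_image_chart fk (f_imm p) cp.
set J := fun q => 'J (f \o chart_bwd c) (chart_fwd c q) in rfp tp.
have cJ : J @ p --> J p.
  apply: (@continuous_comp _ _ _ (chart_fwd c)
    (fun u => 'J (f \o chart_bwd c) u)); first exact: chart_fwd_continuous_at.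
  apply: (Ck_on_continuous_jacobian _ k_ge1 (fk _)).
    exact: chart_cod_open.
  exact: chart_fwd_cod.
have dc : \forall q \near p, chart_dom c q.
  by apply: open_nbhs_nbhs; split; [exact: chart_dom_open|].
have /oU/cJ : frames_of U (J p) by split=> //; exists (gauss f_imm p).
move=> UJ; suff : \forall q \near p, W (gauss f_imm q) by [].
apply: filterS2 dc UJ => q cq UJq; apply: UW.
have [rfq tq] := tangent_image_chart fk (f_imm q) cq.
have [_ [P UP PE]] := UJq rfq; rewrite (_ : gauss f_imm q = P) //.
by apply/val_inj; exact: (etrans tq (esym PE)).
Qed.

(** In one chart at [p] both Jacobians are continuous, and they agree at points of the open set [E];
    uniqueness of limits along [E] gives equality at [p]. *)
Lemma tangent_image_eq_on_closure f g (fk : Ck_map X k f) (gk : Ck_map X k g)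
    (E : set M) : open E -> {in E, f =1 g} ->
  forall p, closure E p -> tangent_image X f p = tangent_image X g p.
Proof.
move=> oE fg p Ep; rewrite !tangent_imageE.
set c := chart (atlas_at X p); have cp : chart_dom c p := atlas_atP X p.
pose J (h : M -> 'rV[R]_(3 + 3)) q := 'J (h \o chart_bwd c) (chart_fwd c q).
suff JJ : J f p = J g p by exact: congr1 JJ.
have cJ h : Ck_map X k h -> J h @ p --> J h p.
  move=> hk; apply: (@continuous_comp _ _ _ (chart_fwd c)
    (fun u => 'J (h \o chart_bwd c) u)); first exact: chart_fwd_continuous_at.
  apply: (Ck_on_continuous_jacobian _ k_ge1 (hk _)).
    exact: chart_cod_open.
  exact: chart_fwd_cod.
have dc : \forall q \near p, chart_dom c q.
  by apply: open_nbhs_nbhs; split; [exact: chart_dom_open|].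
have JE q : chart_dom c q -> E q -> J f q = J g q.
  move=> cq Eq; have cfq := chart_fwd_cod cq.
  have eqn : \forall y \near chart_fwd c q,
      (f \o chart_bwd c) y = (g \o chart_bwd c) y.
    have : \forall y \near chart_fwd c q, E (chart_bwd c y).
      apply: (chart_bwd_continuous_at cfq); apply: open_nbhs_nbhs.
      by rewrite chart_fwdK.
    by apply: filterS => y Ey; apply: fg; exact: mem_set.
  apply: (near_eq_jacobian _ _ eqn).
  - exact: (Ck_on_differentiable k_ge1 (fk _)).
  - exact: (Ck_on_differentiable k_ge1 (gk _)).
(* This filter is proper because [p] lies in the closure of [E]. *)
pose F := within E (nbhs p).
have PF : ProperFilter F by exact: within_nbhs_proper.
have hausdM : hausdorff_space 'M[R]_(3, 3 + 3) by exact: norm_hausdorff.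
have cf : J f @ F --> J f p by apply: cvg_within_filter; exact: cJ.
have cg : J g @ F --> J g p by apply: cvg_within_filter; exact: cJ.
have nJ : \forall q \near nbhs p, E q -> J g q = J f q.
  by apply: filterS dc => q cq Eq; exact: esym (JE q cq Eq).
have cgf : J f @ F --> J g p by exact: (cvg_trans (near_eq_cvg (F := F) nJ) cg).
exact: (cvg_unique hausdM cf cgf).
Qed.

End GaussMap.

(** * Invariance of the boundary of an embedded ball *)

(** The last clause of [topological_embedding] is relative openness of [h] onto its image, that is,
    continuity of the inverse. The point [x0] is the default value of [g] off the image. *)
Lemma embedding_inverse (X Y : topologicalType) (x0 : X) (A : set X)
    (h : X -> Y) : topological_embedding A h ->
  exists2 g : Y -> X, {in A, cancel h g} & {within h @` A, continuous g}.
Proof.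
move=> [_ hI hO].
have [g hK] : exists g : Y -> X, {in A, cancel h g}.
  exists (fun y => xget x0 [set u | A u /\ h u = y]) => u /set_mem Au.
  case: xgetP => [v _ [Av hv]|/(_ u)[]//].
  by apply: hI => //; exact: mem_set.
exists g => //; apply/subspace_continuousP => _ [u Au <-] W /=.
rewrite /from_subspace hK; last exact: mem_set.
rewrite nbhsE => -[U [oU Uu] UW]; have [V oV AUV] := hO U oU.
have Vhu : V (h u) by have : (A `&` U) u by []; rewrite AUV => -[].
apply: filterS (open_nbhs_nbhs (conj oV Vhu)) => z Vz [v Av hv].
suff : W (g z) by [].
rewrite -hv hK; last exact: mem_set.
apply: UW; have : (A `&` h @^-1` V) v by split=> //=; rewrite hv.
by rewrite -AUV => -[].
Qed.

(** * Radial shrinking of the unit ball *)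

Section Balls.
Variable R : realType.
Implicit Types (u : 'rV[R]_3) (s : R).

Lemma sumsq_scale s u : \sum_j (s *: u) 0 j ^+ 2 = s ^+ 2 * \sum_j u 0 j ^+ 2.
Proof. by rewrite big_distrr /=; apply: eq_bigr => j _; rewrite mxE exprMn. Qed.

Lemma sumsq_ge0 u : 0 <= \sum_j u 0 j ^+ 2.
Proof. by apply: sumr_ge0 => j _; exact: sqr_ge0. Qed.

Lemma sphere2_closed_ball3 u : sphere2 R u -> closed_ball3 R u.
Proof. by move=> Su; rewrite /closed_ball3 /= Su. Qed.

Lemma shrink_closed_ball3 s u : 0 <= s <= 1 -> closed_ball3 R u ->
  closed_ball3 R ((1 - s) *: u).
Proof.
move=> /andP[s0 s1] /= u1; rewrite /closed_ball3 /= sumsq_scale.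
by rewrite mulr_ile1 ?sumsq_ge0 ?sqr_ge0 // expr_le1 //; lra.
Qed.

Lemma shrink_open_ball3 s u : 0 < s <= 1 -> closed_ball3 R u ->
  open_ball3 R ((1 - s) *: u).
Proof.
move=> /andP[s0 s1] /= u1; rewrite /open_ball3 /= sumsq_scale.
apply: le_lt_trans (_ : (1 - s) ^+ 2 * 1 < 1).
  by rewrite ler_wpM2l ?sqr_ge0.
by rewrite mulr1 expr_lt1 //; lra.
Qed.

Lemma continuous_shrink (X : topologicalType) (A : set X) (g : X -> 'rV[R]_3)
    (t : X -> R) : {within A, continuous g} -> {within A, continuous t} ->
  {within A, continuous (fun x => (1 - t x) *: g x)}.
Proof.
move=> /subspace_continuousP cg /subspace_continuousP ct.
apply/subspace_continuousP => x Ax; apply: cvgZ; last exact: cg.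
by apply: cvgB; [exact: cvg_cst|exact: ct].
Qed.

End Balls.

Section InvarianceOfBoundary.
Variables (R : realType) (M : topologicalType) (c : chart3 R M).
Variable phi : 'rV[R]_3 -> M.
Hypothesis phi_emb : topological_embedding (closed_ball3 R) phi.

Lemma sphere2_not_interior u : sphere2 R u -> chart_dom c (phi u) ->
  ~ (phi @` closed_ball3 R)° (phi u).
Proof.
move=> Su cp intp; set a := chart_fwd c (phi u).
have Du := sphere2_closed_ball3 Su.
have [phi_cont phi_inj _] := phi_emb.
have [psi phiK psi_cont] := embedding_inverse (0 : 'rV[R]_3) phi_emb.
have ca : chart_cod c a := chart_fwd_cod cp.
have aE : chart_bwd c a = phi u by exact: chart_fwdK.
have : \forall y \near a, chart_cod c y /\
    (phi @` closed_ball3 R) (chart_bwd c y).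
  apply: filterI; first by apply: open_nbhs_nbhs; split; [exact: chart_cod_open|].
  by apply: (chart_bwd_continuous_at ca); rewrite aE.
(* Halving [e] puts the closed cube of half-side [r] inside the open ball of radius [e]. *)
move=> /nbhs_ballP[e /= e0 he]; pose r := e / 2.
have r0 : 0 < r by rewrite /r; lra.
have {}he y : cube a r y -> chart_cod c y /\
    (phi @` closed_ball3 R) (chart_bwd c y).
  move=> Qy; apply: he; split=> // i j; rewrite ord1 /ball /= distrC.
  by have := Qy j; rewrite /= in_itv /= -ler_distl /r => /le_lt_trans; apply; lra.
pose th y := psi (chart_bwd c y).
have thD y : cube a r y -> closed_ball3 R (th y) /\ phi (th y) = chart_bwd c y.
  move=> /he[_ [v Dv vE]]; rewrite /th -vE phiK //; exact: mem_set.
pose Q : set ('rV[R]_3 * R) := cube a r `*` `[0, 1]%classic.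
(* [Phi (y, s)] is [y] moved towards the centre of the ball, by the factor
   [1 - s] in the coordinates of the ball. *)
pose Phi (ys : 'rV[R]_3 * R) := phi ((1 - ys.2) *: th ys.1).
have cPhi : {within Q, continuous Phi}.
  apply: (within_continuous_comp_sub (C := closed_ball3 R)) phi_cont _ => //.
    apply: continuous_shrink; last first.
      by apply: continuous_subspaceT => z; exact: cvg_snd.
    apply: (within_continuous_comp_sub (C := phi @` closed_ball3 R)
      (f := fun ys => chart_bwd c ys.1)) psi_cont _ => //.
      apply: (within_continuous_comp_sub (C := chart_cod c) (f := fst)).
      - by apply: continuous_subspaceT => z; exact: cvg_fst.
      - exact: chart_bwd_continuous.
      - by move=> _ [[y s] [/= Qy _] <-]; have [] := he _ Qy.
    by move=> _ [[y s] [/= Qy _] <-]; have [] := he _ Qy.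
  move=> _ [[y s] [/= Qy +] <-] /=; rewrite in_itv /= => s01.
  by apply: shrink_closed_ball3 => //; have [] := thD _ Qy.
pose P s y := chart_dom c (Phi (y, s)) /\
  forall l, `|chart_fwd c (Phi (y, s)) ord0 l - y ord0 l| < r.
(* At s = 0 the map [Phi] is the identity read in the chart, so small s move points little;
   compactness of the cube makes the bound on s uniform. *)
have nP : \forall s \near 0^'+, cube a r `<=` P s.
  move: (@cube_compact R a r) => /compact_near_coveringP/near_covering_withinP.
  apply => y Qy.
  have Phi0 : Phi (y, 0) = chart_bwd c y.
    by rewrite /Phi /= subr0 scale1r; have [] := thD _ Qy.
  have cy : chart_cod c y by have [] := he _ Qy.
  have dy : chart_dom c (Phi (y, 0)) by rewrite Phi0; exact: chart_bwd_dom.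
  have r20 : 0 < r / 2 by lra.
  have : \forall q \near Phi (y, 0), chart_dom c q /\ ball y (r / 2) (chart_fwd c q).
    apply: filterI; first by apply: open_nbhs_nbhs; split; [exact: chart_dom_open|].
    apply: (chart_fwd_continuous_at dy); rewrite Phi0 chart_bwdK //.
    exact: nbhsx_ballx.
  have Qy0 : Q (y, 0) by split=> //=; rewrite in_itv /= lexx ler01.
  move/subspace_continuousP: cPhi => /(_ _ Qy0) /[apply].
  move=> [[S1 S2] /= [S1y S20] S12].
  exists (S1 `&` ball y (r / 2), S2 `&` `]0, 1[%classic).
    split=> /=; first by apply: filterI => //; exact: nbhsx_ballx.
    apply: filterI; first exact: cvg_within.
    by near=> s; rewrite /= in_itv /=; apply/andP; split=> //.
  move=> [y' s] /= [[S1y' yy'] [S2s]]; rewrite in_itv /= => /andP[s0 s1] Qy'.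
  have [] := S12 (y', s) (conj S1y' S2s).
    by split=> //=; rewrite in_itv /= !ltW.
  move=> dPhi yPhi; split=> // l.
  have := ball_triangle (ball_sym yPhi) yy'; rewrite -splitr => -[_ /(_ ord0 l)].
  by [].
have [s [s0 s1 Ps]] : exists s, [/\ 0 < s, s < 1 & cube a r `<=` P s].
  apply/(@filter_ex _ (0^'+)); near=> s; split=> //; near: s => //.
have s01 : 0 <= s <= 1 by rewrite !ltW.
(* Points move by less than [r] in each coordinate, so on a face at distance [r] from [a] the
   corresponding coordinate of [F] keeps its sign. *)
pose F y := chart_fwd c (Phi (y, s)) - a.
have [] := @poincare_miranda R a r F r0.
- have cPs : {within cube a r, continuous (fun y => Phi (y, s))}.
    apply: (@within_continuous_comp_sub _ _ _ _ Q (fun y => (y, s)) Phi _ cPhi).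
      apply: continuous_subspaceT => y.
      exact: (cvg_pair (F := nbhs y) cvg_id (cvg_cst s)).
    by move=> _ [y Qy <-]; split=> //=; rewrite in_itv.
  have cfw : {within cube a r, continuous (chart_fwd c \o (fun y => Phi (y, s)))}.
    apply: (within_continuous_comp_sub cPs (chart_fwd_continuous (c := c))).
    by move=> _ [y Qy <-]; have [] := Ps _ Qy.
  move/subspace_continuousP: cfw => cfw; apply/subspace_continuousP => y Qy.
  by apply: cvgB; [exact: cfw|exact: cvg_cst].
- move=> y l Qy yl; have [_ /(_ l)] := Ps _ Qy.
  by rewrite /F !mxE ltr_distl yl => /andP[_]; lra.
- move=> y l Qy yl; have [_ /(_ l)] := Ps _ Qy.
  by rewrite /F !mxE ltr_distl yl => /andP[+ _]; lra.
(* At a zero of [F] the moved point is [phi u]. By injectivity [u] equals a strictly shrunk point,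
   which lies in the open ball and not on the sphere. *)
move=> y Qy /subr0_eq Fy; have [Dth _] := thD _ Qy.
have [dPhi _] := Ps _ Qy.
have : Phi (y, s) = phi u by rewrite -(chart_fwdK dPhi) Fy.
move/phi_inj => /(_ _ _)/= thu.
have Dsh : closed_ball3 R ((1 - s) *: th y) by exact: shrink_closed_ball3.
have := @shrink_open_ball3 R s (th y); rewrite s0 ltW // => /(_ isT Dth).
rewrite thu; [|exact: mem_set..].
by rewrite /open_ball3 /= Su ltxx.
Unshelve. all: by end_near. Qed.

End InvarianceOfBoundary.

Lemma closed_ball3_compact (R : realType) : compact (closed_ball3 R).
Proof.
apply: (subclosed_compact _ (@cube_compact R 0 1)) => [|u Du l].
  apply: (@closed_comp _ _ (fun u : 'rV[R]_3 => \sum_j u 0 j ^+ 2)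
    [set t | t <= 1]); last exact: closed_le.
  move=> u _; move: u; apply: (continuous_big add_continuous) => j _ u.
  exact: (cvg_comp _ _ (@coord_continuous _ _ _ 0 j u) (@exprn_continuous _ 2 _)).
have : u 0 l ^+ 2 <= 1.
  apply: le_trans Du; rewrite (bigD1 l) //= lerDl.
  by apply: sumr_ge0 => j _; exact: sqr_ge0.
by move=> h; rewrite /= in_itv /= mxE; apply/andP; split; nra.
Qed.

(** * Closure and boundary of an embedded ball *)

Section EmbeddedBall.
Variables (R : realType) (M : topologicalType) (X : oriented_atlas3 R M).
Variables (B : set M) (phi : 'rV[R]_3 -> M).
Hypothesis hausM : hausdorff_space M.
Hypothesis oB : open B.
Hypothesis phi_emb : topological_embedding (closed_ball3 R) phi.
Hypothesis BE : B = phi @` open_ball3 R.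

(** The image of the closed ball is compact, hence closed in the Hausdorff space [M], and it
    contains [B]. *)
Lemma closure_embedded_ball : closure B `<=` phi @` closed_ball3 R.
Proof.
have [phi_cont _ _] := phi_emb.
have clD : closed (phi @` closed_ball3 R).
  apply: compact_closed => //; apply: continuous_compact => //.
  exact: closed_ball3_compact.
rewrite [X in _ `<=` X]((closure_id _).1 clD); apply: closureS.
by rewrite BE; apply: image_subset => u /ltW.
Qed.

Lemma boundary_embedded_ball :
  topological_boundary B `<=` phi @` sphere2 R.
Proof.
move=> p [/closure_embedded_ball[v Dv vp]]; rewrite -vp ((interior_id B).1 oB) => nB.
exists v => //; apply/eqP; rewrite eq_le; apply/andP; split=> //.
by rewrite leNgt; apply/negP => lt1; apply: nB; rewrite BE; exists v.
Qed.

(** A point outside the closure of the exterior is interior to the closure of [B], hence to the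
    image of the closed ball; [sphere2_not_interior] excludes this on the sphere. *)
Lemma boundary_sub_closure_exterior :
  topological_boundary B `<=` closure (~` closure B).
Proof.
move=> p /boundary_embedded_ball[v Sv <-]; rewrite closure_setC => intp.
have cp := atlas_atP X (phi v).
apply: (sphere2_not_interior phi_emb Sv cp).
exact: (interiorS closure_embedded_ball).
Qed.

End EmbeddedBall.

Theorem mainTheorem3 (R : realType) (M : topologicalType)
    (closedM : closed_space M) (X : oriented_atlas3 R M)
    (k : option nat) (k_ge1 : k <> Some 0%N)
    (f : M -> 'rV[R]_(3 + 3)) (f_emb : Ck_embedding X k f)
    (G : M -> grassmannian R (3 + 3) 3) (G_gauss : is_gauss_map X f G)
    (x : M) (x_isolated : isolated (complex_tangents X f) x)
    (B : set M) (B_ball : embedded_open_ball R B) (xB : B x)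
    (B_nbhs : exists U : set M,
      [/\ open U, closure B `<=` U &
          closure U `&` complex_tangents X f `<=` [set x]])
    (x_removable : removable_in X k f B)
    (i : 'rV[R]_3 -> M) (i_emb : topological_embedding (sphere2 R) i)
    (i_image : i @` sphere2 R = topological_boundary B) :
  null_homotopic_in R (sphere2 R) (totally_real_planes R) (G \o i).
Proof.
have [hausM _ _] := closedM; have [fk _ _] := f_emb.
have [g [[gk g_imm _] gf gB]] := x_removable.
have [oB [phi phi_emb BE]] := B_ball.
have [U [_ BU UC]] := B_nbhs.
have [phi_cont _ _] := phi_emb; have [i_cont _ _] := i_emb.
have fg_bd p : topological_boundary B p ->
    tangent_image X f p = tangent_image X g p.
  move=> /(boundary_sub_closure_exterior X hausM oB phi_emb BE).
  apply: (tangent_image_eq_on_closure k_ge1 fk gk).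
    exact/closed_openC/closed_closure.
  by move=> q /set_mem Bq; rewrite gf // => /subset_closure.
(* Inside [B] this is the choice of [g]. On the boundary the tangent images of [f] and [g] agree,
   and the only complex tangent of [f] in the closure of [B] is [x], which lies in [B]. *)
have g_real p : closure B p -> totally_real (tangent_image X g p).
  move=> clBp; have [Bp|nBp] := pselect (B p).
    by apply: contrapT; exact: gB.
  rewrite -fg_bd; last by split=> //; rewrite ((interior_id B).1 oB).
  apply: contrapT => pC; apply: nBp; rewrite (UC p _) //.
  by split=> //; apply: subset_closure; exact: BU.
have [psi phiK psi_cont] := embedding_inverse (0 : 'rV[R]_3) phi_emb.
have i_bd u : sphere2 R u -> topological_boundary B (i u).
  by move=> Su; rewrite -i_image; exists u.
have psiP u : sphere2 R u -> closed_ball3 R (psi (i u)) /\ phi (psi (i u)) = i u.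
  move=> /i_bd[/(closure_embedded_ball hausM phi_emb BE)[v Dv <-] _].
  by rewrite phiK //; exact: mem_set.
(* The parametrizations [i] and [phi] are unrelated, so [psi] first carries the point of the sphere
   to the coordinates of the ball, where it is contracted to the centre. *)
exists (fun ut => gauss g_imm (phi ((1 - ut.2) *: psi (i ut.1)))); split.
- apply: (@within_continuous_comp_sub _ _ _ _ setT
    (fun ut : 'rV[R]_3 * R => phi ((1 - ut.2) *: psi (i ut.1)))
    (gauss g_imm)) => //; last first.
    by apply: continuous_subspaceT; exact: (gauss_continuous k_ge1 gk).
  apply: (@within_continuous_comp_sub _ _ _ _ (closed_ball3 R)
    (fun ut : 'rV[R]_3 * R => (1 - ut.2) *: psi (i ut.1)) phi _ phi_cont).
    apply: continuous_shrink; last first.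
      by apply: continuous_subspaceT => z; exact: cvg_snd.
    apply: (within_continuous_comp_sub (C := phi @` closed_ball3 R)
      (f := fun ut => i ut.1)) psi_cont _ => //.
      apply: (within_continuous_comp_sub (C := sphere2 R) (f := fst)) i_cont _.
        by apply: continuous_subspaceT => z; exact: cvg_fst.
      by move=> _ [[u t] [/= Su _] <-].
    move=> _ [[u t] [/= Su _] <-] /=.
    by have [Du <-] := psiP _ Su; exists (psi (i u)).
  move=> _ [[u t] [/= Su +] <-] /=; rewrite in_itv /= => t01.
  by apply: shrink_closed_ball3 => //; have [] := psiP _ Su.
(* For t = 0 the point is on the boundary of [B], for t > 0 inside [B]; [g_real] covers both. *)
- move=> u t Su /andP[t0 t1] /=; apply: g_real; have [Du uE] := psiP _ Su.
  move: t0; rewrite le_eqVlt => /predU1P[<-|t0].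
    by rewrite subr0 scale1r uE; have [] := i_bd _ Su.
  apply: subset_closure; rewrite BE; apply: imageP.
  by apply: shrink_open_ball3 => //; rewrite t0.
- move=> u Su; have [_ uE] := psiP _ Su; apply/val_inj => /=.
  by rewrite subr0 scale1r uE G_gauss fg_bd //; exact: i_bd.
- exists (gauss g_imm (phi 0)) => u _.
  by rewrite /= subrr scale0r.
Qed.
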